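(* Let $\mathcal C$ be a countable collection of languages over a countably infinite universe $U$. Then $\mathcal C$ is generatable in the limit without samples if and only if $\bigl|\bigcap_{L\in\mathcal C'}L\bigr|=\infty$ for every finite $\mathcal C'\subseteq\mathcal C$.
   Context: A language is an infinite subset of $U$. A generator without samples is an injection $G:\mathbb N\to U$, with output $z_t=G(t)$. $G$ generates in the limit without samples for $\mathcal C$ if for every $K\in\mathcal C$ there exists $t^\star$ such that $z_t\in K$ for all $t\ge t^\star$; $\mathcal C$ is generatable in the limit without samples if such $G$ exists. *)

(* Defs.v *)
From mathcomp Require Import all_boot.
From mathcomp Require Import boolp classical_sets functions cardinality.

Set Implicit Arguments.
Unset Strict Implicit.
Unset Printing Implicit Defensive.

Local Open Scope classical_set_scope.

Definition language (U : Type) (L : set U) : Prop := infinite_set L.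

Definition generates_in_limit_without_samples (U : Type) (C : set (set U))
    (G : nat -> U) : Prop :=
  forall K : set U, C K -> exists tstar : nat, forall t : nat, tstar <= t -> K (G t).

Definition generatable_in_limit_without_samples (U : Type) (C : set (set U)) : Prop :=
  exists G : nat -> U, injective G /\ generates_in_limit_without_samples C G.

(* Main.v *)
Require Import Defs.
From mathcomp Require Import all_boot.
From mathcomp Require Import boolp classical_sets functions cardinality.

Local Open Scope classical_set_scope.

(** If [G] generates in the limit, then all but finitely many of its (pairwise
    distinct) outputs lie in any given finite intersection, which is therefore
    infinite. Conversely, enumerate the collection as [L_0, L_1, ...] and pick
    greedily [G n] in [L_0 `&` ... `&` L_(n-1)] different from [G 0, ..., G (n-1)]. *)

Lemma finite_set_nat_bounded (A : set nat) :
  finite_set A -> exists N : nat, forall n : nat, A n -> n <= N.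
Proof.
move=> /finite_seqP[s ->]; exists (\max_(i <- s) i) => n /= ns.
exact: (@leq_bigmax_seq _ s xpredT id).
Qed.

Lemma infinite_set_inj_range {U : Type} (A : set U) (f : nat -> U) :
  injective f -> (forall n, A (f n)) -> infinite_set A.
Proof.
move=> f_inj fA Afin; apply: infinite_nat.
apply: (sub_finite_set (B := f @^-1` A)) => [n _|]; first exact: fA.
by apply: finite_preimage Afin => x y _ _; exact: f_inj.
Qed.

(** Removing the finitely many values chosen before stage [n] from the infinite set [S n] always
    leaves a point to choose. *)
Lemma infinite_sets_inj_transversal {U : Type} (S : nat -> set U) :
  (forall n, infinite_set (S n)) ->
  exists G : nat -> U, injective G /\ forall n, S n (G n).
Proof.
move=> Sinf; have [x0 _] := infinite_setN0 (Sinf 0).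
(* A pair [p] consists of a stage and a set of forbidden values; [x0] is a junk value for infinite
   [p.2]. *)
have /choice[h hP] : forall p : nat * set U, exists x,
    finite_set p.2 -> S p.1 x /\ ~ p.2 x.
  case=> n A /=; case: (pselect (finite_set A)) => [Afin|]; last by exists x0.
  by have [x ?] := infinite_setN0 (infinite_setD (Sinf n) Afin); exists x.
(* [F n] collects the values chosen before stage [n]; carrying this set along makes the greedy
   choice a plain recursion on [n]. *)
pose F := nat_rect (fun=> set U) set0 (fun n A => h (n, A) |` A).
have Ffin n : finite_set (F n).
  elim: n => [|n IHn] /=; first exact: finite_set0.
  by rewrite finite_setU; split=> //; exact: finite_set1.
pose G n := h (n, F n).
have FG m n : m < n -> F n (G m).
  elim: n => // n IHn; rewrite ltnS leq_eqVlt => /predU1P[->|/IHn Fm]; first by left.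
  by right.
have GF n : ~ F n (G n) by have [] := hP (n, F n) (Ffin n).
exists G; split=> [m n Gmn|n]; last by have [] := hP (n, F n) (Ffin n).
case: (ltngtP m n) => // [/FG|/FG]; first by rewrite Gmn => /GF.
by rewrite -Gmn => /GF.
Qed.

Theorem theorem4p4 (U : Type) (U_countable : countable [set: U])
    (U_infinite : infinite_set [set: U])
    (C : set (set U)) (C_countable : countable C)
    (C_languages : forall L : set U, C L -> language L) :
  generatable_in_limit_without_samples C <->
  (forall C' : set (set U), C' `<=` C -> finite_set C' ->
     infinite_set (\bigcap_(L in C') L)).
Proof.
split=> [[G [G_inj G_gen]] C' C'C C'fin|Cinf].
  have /choice[T TP] : forall L, exists T, C L -> forall t, T <= t -> L (G t).
    move=> L; case: (pselect (C L)) => [/G_gen[T LT]|]; last by exists 0.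
    by exists T.
  have [N NP] := finite_set_nat_bounded _ (finite_image T C'fin).
  (* [N] bounds the thresholds of all members of [C'], so the sequence shifted by [N] stays in each
     of them. *)
  apply: (@infinite_set_inj_range _ _ (fun n => G (N + n))).
    by move=> m n /G_inj /addnI.
  move=> n L C'L; apply: (TP _ (C'C _ C'L)); apply: leq_trans (leq_addr n N).
  by apply: NP; exists L.
have /countable_injP[f f_inj] := C_countable.
(* The injection [f] replaces an enumeration, so finite or empty [C] is no special case. [Cn n] is
   finite because [f] embeds it into the numbers below [n]. *)
pose Cn n := [set L | C L /\ f L < n].
have Cn_fin n : finite_set (Cn n).
  have Cn_inj : {in Cn n &, injective f}.
    move=> L M; rewrite !inE => -[CL _] [CM _]; apply: f_inj; exact/mem_set.
  rewrite -(eq_finite_set (inj_card_eq Cn_inj)).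
  by apply: sub_finite_set (finite_II n) => _ [L [_ ?] <-].
have [G [G_inj GP]] := infinite_sets_inj_transversal
  (fun n => \bigcap_(L in Cn n) L) (fun n => Cinf _ (fun L => @proj1 _ _) (Cn_fin n)).
(* The successor comes from the strict bound in [Cn]: [K] belongs to [Cn t] exactly when
   [f K < t]. *)
exists G; split=> // K CK; exists (f K).+1 => t ft.
exact: (GP t).
Qed.
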